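(* Let $1\le k_1<\cdots<k_r\le n$ be integers, $k_0=0$, $k_{r+1}=n$. Let $A$ be a generic real symmetric $n\times n$ matrix and let $X_0=\mathrm{diag}(c_1,\ldots,c_n)$ with $c_{k_j+1}=\cdots=c_{k_{j+1}}$ for $j=0,\ldots,r$, where the values of different blocks are distinct. The algebraic set of complex critical points of the optimization problem $$\min/\max\ \operatorname{trace}(AQX_0Q^T)\quad\text{subject to } Q^TQ=\mathrm{Id}_n$$ is equal to $$\bigsqcup_{\sigma\in S_n/(S_{k_1}\times S_{k_2-k_1}\times\cdots\times S_{n-k_r})}\{U(\sigma\cdot R)\;:\;R\in\mathrm{O}(k_1)\times\mathrm{O}(k_2-k_1)\times\cdots\times\mathrm{O}(n-k_r)\},$$ where $U=[u_1\,u_2\,\cdots\,u_n]$ for $u_1,\ldots,u_n$ an orthonormal eigenbasis of $A$ and $\sigma$ acts by permuting the rows of $R$. This algebraic set is a disjoint union of $\binom{n}{k_1,\,k_2-k_1,\,\ldots,\,n-k_r}$ varieties isomorphic to $\mathrm{O}(k_1)\times\mathrm{O}(k_2-k_1)\times\cdots\times\mathrm{O}(n-k_r)$.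
   Context: $\mathrm{O}(m)=\{Q\in\mathbb{C}^{m\times m}:Q^TQ=\mathrm{Id}_m\}$ is the complex orthogonal group; the product $\mathrm{O}(k_1)\times\mathrm{O}(k_2-k_1)\times\cdots\times\mathrm{O}(n-k_r)$ is regarded as the group of block diagonal matrices in $\mathrm{O}(n)$ with blocks of these sizes, and $S_{k_1}\times S_{k_2-k_1}\times\cdots\times S_{n-k_r}$ as the corresponding Young subgroup of the symmetric group $S_n$; the union is over left cosets (the set attached to a coset does not depend on the representative). A complex critical point is a matrix $Q\in\mathbb{C}^{n\times n}$ with $Q^TQ=\mathrm{Id}_n$ such that the gradient of the objective at $Q$ lies in the linear span of the gradients at $Q$ of the entries of $Q^TQ-\mathrm{Id}_n$. The $c_i$ are complex numbers. $\binom{n}{m_1,\ldots,m_s}=\frac{n!}{m_1!\cdots m_s!}$. ''Generic'' means: for all $A$ outside some proper Zariski closed subset of the space of symmetric matrices. *)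

(* Defs.v *)
From HB Require Import structures.
From mathcomp Require Import all_boot all_order all_fingroup all_algebra.
From mathcomp Require Import reals.
From mathcomp Require Import complex.
From mathcomp Require Import mpoly.

Set Implicit Arguments.
Unset Strict Implicit.
Unset Printing Implicit Defensive.

Import GRing.Theory.

Local Open Scope ring_scope.

(* Polynomials on the space of n x n matrices are elements of {mpoly F[n * n]};
   the variable attached to the entry (i, j) is 'X_(mxvec_index i j), which is
   the numbering used by mxvec. *)

Definition generic_mx (F : fieldType) (n : nat) : 'M[{mpoly F[n * n]}]_n :=
  \matrix_(i, j) 'X_(mxvec_index i j).

Definition const_poly_mx (F : fieldType) (n : nat) (B : 'M[F]_n) :
    'M[{mpoly F[n * n]}]_n :=
  map_mx (@mpolyC (n * n) F) B.

Definition peval (F : fieldType) (n : nat) (Q : 'M[F]_n)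
    (p : {mpoly F[n * n]}) : F :=
  p.@[fun l => mxvec Q 0 l].

Definition gradient (F : fieldType) (n : nat) (p : {mpoly F[n * n]})
    (Q : 'M[F]_n) : 'M[F]_n :=
  \matrix_(i, j) peval Q p^`M(mxvec_index i j).

Definition objective (F : fieldType) (n : nat) (A X : 'M[F]_n) :
    {mpoly F[n * n]} :=
  \tr (const_poly_mx A *m generic_mx F n *m const_poly_mx X
         *m (generic_mx F n)^T).

Definition orthogonality (F : fieldType) (n : nat) (i j : 'I_n) :
    {mpoly F[n * n]} :=
  ((generic_mx F n)^T *m generic_mx F n - 1%:M) i j.

Definition critical_point (F : fieldType) (n : nat) (A X Q : 'M[F]_n) : Prop :=
  Q^T *m Q = 1%:M /\
  gradient (objective A X) Q \in
    <<[seq gradient (orthogonality F ij.1 ij.2) Q | ij : 'I_n * 'I_n]>>%VS.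

Definition algebraic_set (F : fieldType) (n : nat) (V : 'M[F]_n -> Prop) :
    Prop :=
  exists s : seq {mpoly F[n * n]},
    forall Q, V Q <-> (forall p, p \in s -> peval Q p = 0).

Definition poly_map (F : fieldType) (n : nat) (P : 'M[{mpoly F[n * n]}]_n)
    (Q : 'M[F]_n) : 'M[F]_n :=
  map_mx (peval Q) P.

(* Morphisms between closed algebraic subsets of affine space are the
   restrictions of polynomial maps. *)
Definition isomorphic_varieties (F : fieldType) (n : nat)
    (V W : 'M[F]_n -> Prop) : Prop :=
  exists P P' : 'M[{mpoly F[n * n]}]_n,
    (forall Q, V Q -> W (poly_map P Q) /\ poly_map P' (poly_map P Q) = Q) /\
    (forall Q, W Q -> V (poly_map P' Q) /\ poly_map P (poly_map P' Q) = Q).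

(* The symmetric matrices being a linear subspace of all matrices, their
   Zariski closed subsets are the algebraic sets of matrices they contain. *)
Definition proper_closed_sym (F : fieldType) (n : nat) (Z : 'M[F]_n -> Prop) :
    Prop :=
  [/\ algebraic_set Z,
      forall B, Z B -> B^T = B
    & exists B : 'M[F]_n, B^T = B /\ ~ Z B].

Definition orthonormal_eigenbasis (F : fieldType) (n : nat) (A U : 'M[F]_n) :
    Prop :=
  U^T *m U = 1%:M /\
  forall i, exists l : F, A *m col i U = l *: col i U.

(* Indices are counted from 0, so that block j, for 0 <= j <= r, is
   {k j, ..., (k j.+1).-1}. *)
Definition in_block (n : nat) (k : nat -> nat) (j : nat) (i : 'I_n) : bool :=
  (k j <= i < k j.+1)%N.

Definition same_block (n r : nat) (k : nat -> nat) (i i' : 'I_n) : bool :=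
  [exists j : 'I_r.+1, in_block k j i && in_block k j i'].

Definition block_orthogonal (F : fieldType) (n r : nat) (k : nat -> nat)
    (R : 'M[F]_n) : Prop :=
  R^T *m R = 1%:M /\ forall i i', ~~ same_block r k i i' -> R i i' = 0.

Definition young (n r : nat) (k : nat -> nat) : {set 'S_n} :=
  [set s : 'S_n |
    [forall j : 'I_r.+1, forall i, in_block k j i ==> in_block k j (s i)]].

Lemma young_group_set (n r : nat) (k : nat -> nat) : group_set (young n r k).
Proof.
apply/group_setP; split=> [|s t].
  by rewrite inE; apply/forallP=> j; apply/forallP=> i; rewrite perm1 implybb.
rewrite !inE => /forallP hs /forallP ht.
apply/forallP=> j; apply/forallP=> i; apply/implyP=> hi; rewrite permM.
by apply: (implyP (forallP (ht j) _)); apply: (implyP (forallP (hs j) _)).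
Qed.

Canonical young_group (n r : nat) (k : nat -> nat) :=
  Group (young_group_set n r k).

(* The set {U (s . R) : R block orthogonal} attached to a left coset S of the
   Young subgroup, s being any element of S.  Permutations compose from left to
   right in 'S_n, and row_perm (s * t) R = row_perm s (row_perm t R): row_perm
   is a left action, so it is indeed left cosets that are to be used with it,
   and the set does not depend on the choice of s (coset_varietyE). *)
Definition coset_variety (F : fieldType) (n r : nat) (k : nat -> nat)
    (U : 'M[F]_n) (S : {set 'S_n}) (Q : 'M[F]_n) : Prop :=
  exists2 s, s \in S &
  exists2 R, block_orthogonal r k R & Q = U *m row_perm s R.

Lemma coset_varietyE (F : fieldType) (n r : nat) (k : nat -> nat)
    (U : 'M[F]_n) (s : 'S_n) (Q : 'M[F]_n) :
  coset_variety r k U (s *: young n r k)%g Q <->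
  exists2 R, block_orthogonal r k R & Q = U *m row_perm s R.
Proof.
split=> [[t /lcosetP [y hy ->]] [R [hR hb] ->]|[R hR ->]]; last first.
  by exists s; [apply: lcoset_refl | exists R].
exists (row_perm y R); last by congr (_ *m _); apply/matrixP=> i j; rewrite !mxE permM.
split=> [|i i' hi].
  rewrite row_permE trmx_mul mulmxA -(mulmxA R^T) tr_perm_mx -perm_mxM mulVg.
  by rewrite perm_mx1 mulmx1.
rewrite mxE; apply: hb; apply: contra hi => /existsP [j /andP [h1 h2]].
apply/existsP; exists j; rewrite h2 andbT.
have hV: (y^-1)%g \in young n r k by rewrite groupV.
move: hV; rewrite inE => /forallP /(_ j) /forallP /(_ (y i)) /implyP /(_ h1).
by rewrite permK.
Qed.

(* Main.v *)
From HB Require Import structures.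
Require Import Defs.
From mathcomp Require Import all_boot all_order all_fingroup all_algebra.
From mathcomp Require Import reals.
From mathcomp Require Import complex.
From mathcomp Require Import mpoly.

(** Write X for the diagonal matrix of the c_i.  The gradient of the objective
    at Q is 2 A Q X, and those of the constraints are the matrices
    Q (E_ij + E_ji), which span Q * (symmetric matrices); so an orthogonal Q is
    critical exactly when Q^T A Q X is symmetric, that is, when Q^T A Q
    commutes with X ([critical_pointE]).

    Generic here means that A has no repeated eigenvalue.  The excluded locus is
    the vanishing of the determinant of the matrix of power traces tr(A^(i+j)):
    in an eigenbasis this matrix is V V^T for V the Vandermonde matrix of the
    eigenvalues, so its determinant is the discriminant of the characteristic
    polynomial ([det_power_trace_mx]).

    Now let A = U D U^T with D diagonal without repeated entry, and put
    W = U^T Q.  That W^T D W commutes with X means that D commutes with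
    Y = W X W^T, hence that Y is diagonal.  From W X = Y W, each entry W_ij
    other than 0 forces c_j = Y_ii, so that row i of W lives in the columns of
    one block.  As det W is not 0, the Leibniz formula provides a permutation s
    with W_(i, s i) different from 0 for every i, and then the block of row i is
    that of s i: W is a block orthogonal matrix with its rows permuted by s
    ([commute_conj_diagP]).  The rows of W determine s up to the Young subgroup,
    whence the disjointness; and Q |-> s^-1 . (U^T Q) is a linear isomorphism
    from the piece of s to the block orthogonal matrices.

    The Young subgroup consists of the permutations preserving a colouring of
    the indices by blocks; such a permutation is an independent choice of one
    permutation of each block ([card_colour_preserving]), and Lagrange's theorem
    turns the order of the subgroup into the number of cosets. *)

Set Implicit Arguments.
Unset Strict Implicit.
Unset Printing Implicit Defensive.

Import Order.TTheory GRing.Theory Num.Theory.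

Local Open Scope ring_scope.

(** * Gradients and the critical equation *)

Section Calculus.

Variables (F : fieldType) (n : nat).
Implicit Types (A B X Q S : 'M[F]_n) (P : 'M[{mpoly F[n * n]}]_n).

HB.instance Definition _ Q := GRing.RMorphism.copy (@peval F n Q)
  (meval (fun l => mxvec Q 0 l)).

Lemma poly_map_generic Q : poly_map (generic_mx F n) Q = Q.
Proof. by apply/matrixP=> i j; rewrite !mxE /peval mevalXU mxvecE. Qed.

Lemma poly_map_const B Q : poly_map (const_poly_mx B) Q = B.
Proof. by apply/matrixP=> i j; rewrite !mxE /peval mevalC. Qed.

Lemma poly_mapM P1 P2 Q : poly_map (P1 *m P2) Q = poly_map P1 Q *m poly_map P2 Q.
Proof. exact: map_mxM. Qed.

Lemma poly_mapB P1 P2 Q : poly_map (P1 - P2) Q = poly_map P1 Q - poly_map P2 Q.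
Proof. exact: map_mxB. Qed.

Lemma poly_map_tr P Q : poly_map P^T Q = (poly_map P Q)^T.
Proof. by apply/matrixP=> i j; rewrite !mxE. Qed.

Lemma poly_map1 Q : poly_map 1%:M Q = 1%:M.
Proof. exact: map_mx1. Qed.

Definition poly_mapE := (poly_map_generic, poly_map_const, poly_mapM,
  poly_mapB, poly_map_tr, poly_map1).

Lemma peval_entry P Q i j : peval Q (P i j) = poly_map P Q i j.
Proof. by rewrite mxE. Qed.

(** Differentiating matrices entrywise gives the product rule [deriv_mxM] for
    matrix products, so that gradients need no expansion into entries. *)
Definition deriv_mx (l : 'I_(n * n)) P := map_mx (mderiv l) P.

Lemma deriv_mxM l P1 P2 :
  deriv_mx l (P1 *m P2) = deriv_mx l P1 *m P2 + P1 *m deriv_mx l P2.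
Proof.
apply/matrixP=> i j; rewrite !mxE raddf_sum -big_split /=.
by apply: eq_bigr => h _; rewrite mderivM !mxE.
Qed.

Lemma deriv_mx_const l B : deriv_mx l (const_poly_mx B) = 0.
Proof. by apply/matrixP=> i j; rewrite !mxE mderivC. Qed.

Lemma deriv_mx_tr l P : deriv_mx l P^T = (deriv_mx l P)^T.
Proof. by apply/matrixP=> i j; rewrite !mxE. Qed.

Lemma mxvec_index_inj i j a b :
  (@mxvec_index n n i j == mxvec_index a b) = (i == a) && (j == b).
Proof.
apply/eqP/andP => [|[/eqP-> /eqP->] //].
by move/cast_ord_inj/enum_rank_inj => [-> ->].
Qed.

Lemma deriv_mx_generic a b :
  deriv_mx (mxvec_index a b) (generic_mx F n) = const_poly_mx (delta_mx a b).
Proof.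
apply/matrixP=> i j; rewrite !mxE mderivX mnm1E mxvec_index_inj.
case: (boolP (_ && _)) => [/andP[/eqP-> /eqP->]|_].
  have -> : (U_(mxvec_index a b) - U_(mxvec_index a b) = 0)%MM.
    by apply/mnmP=> l; rewrite mnmBE subnn mnm0E.
  by rewrite scale1r mpolyX0.
by rewrite scale0r mpolyC0.
Qed.

Lemma mxtrace_mulmx_delta (M : 'M[F]_n) a b : \tr (M *m delta_mx a b) = M b a.
Proof.
rewrite /mxtrace (bigD1 b) //= big1 ?addr0 => [|i ib].
  rewrite mxE (bigD1 a) //= big1 ?addr0 => [|j ja].
    by rewrite mxE !eqxx mulr1.
  by rewrite mxE (negPf ja) mulr0.
by rewrite mxE big1 // => j _; rewrite mxE (negPf ib) andbF mulr0.
Qed.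

(** The derivative in direction E_ab is tr(A E_ab X Q^T) + tr(A Q X E_ab^T); the
    symmetry of A and X makes both traces equal to the entry (a, b) of A Q X. *)
Lemma gradient_objective A X Q : A^T = A -> X^T = X ->
  gradient (objective A X) Q = 2%:R *: (A *m Q *m X).
Proof.
move=> sA sX; apply/matrixP=> a b; rewrite [LHS]mxE /objective.
set M := _ *m _.
have -> : (\tr M)^`M(mxvec_index a b) = \tr (deriv_mx (mxvec_index a b) M).
  rewrite /mxtrace raddf_sum; apply: eq_bigr => i _. by rewrite [RHS]mxE.
rewrite /M !(deriv_mxM, deriv_mx_const, deriv_mx_tr, deriv_mx_generic).
have tr_peval (P : 'M[{mpoly F[n * n]}]_n) : peval Q (\tr P) = \tr (poly_map P Q).
  rewrite /mxtrace rmorph_sum; apply: eq_bigr => i _.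
  exact: peval_entry.
rewrite !mul0mx mulmx0 addr0 add0r tr_peval.
rewrite [poly_map _ _]map_mxD -!/(poly_map _ _) !poly_mapE mxtraceD.
rewrite trmx_delta mxtrace_mulmx_delta -mulmxA mxtrace_mulC !mulmxA.
rewrite mxtrace_mulmx_delta.
have -> : X *m Q^T *m A = (A *m Q *m X)^T by rewrite !trmx_mul sA sX mulmxA.
by rewrite [_^T _ _]mxE -mulr2n [RHS]mxE mulr_natl.
Qed.

Lemma gradient_orthogonality (i j : 'I_n) Q :
  gradient (orthogonality F i j) Q = Q *m (delta_mx i j + delta_mx j i).
Proof.
apply/matrixP=> a b; rewrite mxE /orthogonality.
set M := _ - _.
have -> : (M i j)^`M(mxvec_index a b) = deriv_mx (mxvec_index a b) M i j.
  by rewrite [RHS]mxE.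
have -> : deriv_mx (mxvec_index a b) M =
    (const_poly_mx (delta_mx a b))^T *m generic_mx F n +
    (generic_mx F n)^T *m const_poly_mx (delta_mx a b).
  rewrite -deriv_mx_generic -deriv_mx_tr -deriv_mxM /M.
  apply/matrixP=> u v; rewrite !mxE mderivB.
  by rewrite -mpolyC_nat mderivC subr0.
rewrite peval_entry [poly_map _ _]map_mxD -!/(poly_map _ _) !poly_mapE trmx_delta.
rewrite mulmxDr !mxE addrC; congr (_ + _).
- rewrite (bigD1 a) //= big1 ?addr0 => [|h ha]; last first.
    by rewrite !mxE (negPf ha) mulr0.
  rewrite (bigD1 i) //= big1 ?addr0 => [|h hi]; last first.
    by rewrite !mxE (negPf hi) mulr0.
  by rewrite !mxE !eqxx [b == j]eq_sym.
- rewrite (bigD1 a) //= big1 ?addr0 => [|h ha]; last first.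
    by rewrite !mxE (negPf ha) andbF mul0r.
  rewrite [RHS](bigD1 j) //= big1 ?addr0 => [|h hi]; last first.
    by rewrite !mxE (negPf hi) mulr0.
  by rewrite !mxE !eqxx /= andbT mulrC eq_sym.
Qed.

(** Since Q is invertible with inverse Q^T, it suffices that the matrices
    E_ij + E_ji span the symmetric ones, which needs 2 to be invertible. *)
Lemma span_gradient_orthogonality Q G : 2%:R != 0 :> F -> Q^T *m Q = 1%:M ->
  G \in <<[seq gradient (orthogonality F ij.1 ij.2) Q | ij : 'I_n * 'I_n]>>%VS
  <-> (Q^T *m G)^T = Q^T *m G.
Proof.
move=> two_neq0 QtQ; set gs := [seq _ | _ : _]; split.
  move/(@coord_span _ _ _ (in_tuple gs)) => ->.
  rewrite mulmx_sumr raddf_sum /=; apply: eq_bigr => l _.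
  have /mapP[[i j] _ ->] : (in_tuple gs)`_l \in gs by rewrite mem_nth.
  rewrite gradient_orthogonality -scalemxAr linearZ /= mulmxA QtQ mul1mx.
  by rewrite linearD /= !trmx_delta addrC.
move=> symG; pose S := Q^T *m G.
(* Summing over all ordered pairs meets each E_ij twice, hence the halves. *)
have -> : G = \sum_i \sum_j (S i j / 2%:R) *: (Q *m (delta_mx i j + delta_mx j i)).
  rewrite -[LHS]mul1mx -(mulmx1C QtQ) -mulmxA -/S.
  under eq_bigr => i _ do (under eq_bigr => j _ do rewrite scalemxAr; rewrite -mulmx_sumr).
  rewrite -mulmx_sumr; congr (_ *m _).
  under eq_bigr => i _ do (under eq_bigr => j _ do rewrite scalerDr; rewrite big_split).
  rewrite big_split /= [X in _ + X]exchange_big /= -big_split /=.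
  rewrite [LHS]matrix_sum_delta; apply: eq_bigr => i _; rewrite -big_split /=.
  apply: eq_bigr => j _; rewrite -scalerDl; congr (_ *: _).
  have -> : S j i = S i j by rewrite -[RHS]/((Q^T *m G) i j) -symG [RHS]mxE.
  by rewrite -mulrDl -mulr2n -[S i j *+ 2]mulr_natr mulfK.
apply: memv_suml => i _; apply: memv_suml => j _; apply: memvZ.
rewrite -gradient_orthogonality; apply: memv_span.
by apply/mapP; exists (i, j); rewrite ?mem_enum.
Qed.

(** Lagrange's condition says that Q^T A Q X is symmetric; its transpose is
    X Q^T A Q. *)
Lemma critical_pointE A X Q : 2%:R != 0 :> F -> A^T = A -> X^T = X ->
  critical_point A X Q <->
  Q^T *m Q = 1%:M /\ Q^T *m A *m Q *m X = X *m (Q^T *m A *m Q).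
Proof.
move=> two_neq0 sA sX; rewrite /critical_point gradient_objective //.
suff eqv : Q^T *m Q = 1%:M ->
  2%:R *: (A *m Q *m X) \in
    <<[seq gradient (orthogonality F ij.1 ij.2) Q | ij : 'I_n * 'I_n]>>%VS
  <-> Q^T *m A *m Q *m X = X *m (Q^T *m A *m Q).
  by split=> -[QtQ H]; split=> //; apply/eqv.
move=> QtQ; rewrite span_gradient_orthogonality //.
rewrite -scalemxAr linearZ /= !trmx_mul trmxK sA sX !mulmxA.
by split=> [/(scalerI two_neq0)|] ->.
Qed.

(** Allows an algebraic set to be cut out by matrix equations. *)
Lemma algebraic_set_entries (s : seq 'M[{mpoly F[n * n]}]_n) (V : 'M[F]_n -> Prop) :
  (forall Q, V Q <-> (forall P, P \in s -> poly_map P Q = 0)) -> algebraic_set V.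
Proof.
move=> hV; exists [seq (P : 'M[{mpoly F[n * n]}]_n) ij.1 ij.2
    | P <- s, ij <- enum {: 'I_n * 'I_n}] => Q.
rewrite hV; split=> [h p /allpairsP[[P [i j]] /= [Ps _ ->]]|h P Ps].
  by rewrite peval_entry h // mxE.
apply/matrixP=> i j; rewrite -peval_entry mxE; apply: h.
by apply/allpairsP; exists (P, (i, j)); rewrite mem_enum.
Qed.

Lemma critical_set_algebraic A X : 2%:R != 0 :> F -> A^T = A -> X^T = X ->
  algebraic_set (critical_point A X).
Proof.
move=> two_neq0 sA sX.
pose Y := generic_mx F n; pose B := Y^T *m const_poly_mx A *m Y.
apply: (@algebraic_set_entries
  [:: Y^T *m Y - 1%:M; B *m const_poly_mx X - const_poly_mx X *m B]) => Q.
rewrite critical_pointE //; split=> [[h1 h2] P|h].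
  by rewrite !inE => /orP[]/eqP ->; rewrite !poly_mapE ?h1 ?h2 subrr.
split; apply/eqP; rewrite -subr_eq0; apply/eqP.
  by rewrite -(h (Y^T *m Y - 1%:M)) ?inE ?eqxx // !poly_mapE.
by rewrite -[RHS](h (B *m const_poly_mx X - const_poly_mx X *m B))
  ?inE ?eqxx ?orbT // !poly_mapE.
Qed.

End Calculus.

(** * The discriminant and real eigenbases *)

Definition power_trace_mx (K : pzRingType) (n : nat) (A : 'M[K]_n) : 'M[K]_n :=
  \matrix_(i, j) \tr (A ^+ (i + j)).

Lemma map_power_trace_mx (K L : pzRingType) (f : {rmorphism K -> L}) n
    (A : 'M[K]_n) :
  map_mx f (power_trace_mx A) = power_trace_mx (map_mx f A).
Proof. by apply/matrixP=> i j; rewrite !mxE -trace_map_mx rmorphXn. Qed.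

(** Each tr(A^m) is the power sum of the eigenvalues, so the matrix of power
    traces is the Vandermonde matrix times its transpose. *)
Lemma det_power_trace_mx (F : fieldType) n (A U V : 'M[F]_n) (d : 'rV[F]_n) :
  U *m V = 1%:M -> A *m U = U *m diag_mx d ->
  \det (power_trace_mx A) = \det (Vandermonde n d) ^+ 2.
Proof.
move=> UV AU.
have powU m : A ^+ m *m U = U *m diag_mx (\row_j d 0 j ^+ m).
  elim: m => [|m IHm].
    rewrite expr0 mul1mx (_ : diag_mx _ = 1%:M) ?mulmx1 //.
    by apply/matrixP=> i j; rewrite !mxE expr0.
  rewrite exprSr -mulmxA AU mulmxA IHm -mulmxA mulmx_diag.
  by congr (_ *m diag_mx _); apply/rowP=> j; rewrite !mxE exprSr.
have trA m : \tr (A ^+ m) = \sum_l d 0 l ^+ m.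
  rewrite -[A ^+ m]mulmx1 -UV mulmxA powU mxtrace_mulC mulmxA (mulmx1C UV) mul1mx.
  by rewrite mxtrace_diag; apply: eq_bigr => l _; rewrite mxE.
rewrite expr2 -[in X in _ = _ * X]det_tr -det_mulmx; congr (\det _).
apply/matrixP=> i j; rewrite !mxE trA.
by apply: eq_bigr => l _; rewrite !mxE exprD.
Qed.

Lemma det_Vandermonde_neq0 (F : fieldType) n (d : 'rV[F]_n) :
  \det (Vandermonde n d) != 0 <-> injective (d 0).
Proof.
rewrite det_Vandermonde; split=> [/prodf_neq0 nz i j dij|inj].
  have lt_neq (a b : 'I_n) : (a < b)%N -> d 0 a != d 0 b.
    by move=> ab; have /prodf_neq0/(_ b ab) := nz a isT; rewrite subr_eq0 eq_sym.
  apply/val_inj; case: (ltngtP i j) => // /lt_neq; by rewrite dij eqxx.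
apply/prodf_neq0 => i _; apply/prodf_neq0 => j ij.
by rewrite subr_eq0; apply: contraTneq ij => /inj ->; rewrite ltnn.
Qed.

Lemma det_power_trace_neq0 (F : fieldType) n (A U V : 'M[F]_n) (d : 'rV[F]_n) :
  U *m V = 1%:M -> A *m U = U *m diag_mx d ->
  \det (power_trace_mx A) != 0 <-> injective (d 0).
Proof.
move=> UV AU; rewrite (det_power_trace_mx UV AU) sqrf_eq0.
exact: det_Vandermonde_neq0.
Qed.

(** The determinant is the discriminant of the characteristic polynomial, in a
    form that is visibly polynomial in the entries. *)
Definition repeated_eigenvalue_locus (F : fieldType) n (B : 'M[F]_n) : Prop :=
  B^T = B /\ \det (power_trace_mx B) = 0.

Lemma repeated_eigenvalue_locus_proper (F : numFieldType) n :
  proper_closed_sym (@repeated_eigenvalue_locus F n).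
Proof.
split=> [|B []//|].
  pose Y := generic_mx F n.
  exists (\det (power_trace_mx Y)
          :: [seq (Y^T - Y) ij.1 ij.2 | ij <- enum {: 'I_n * 'I_n}]) => Q.
  have evdet : peval Q (\det (power_trace_mx Y)) = \det (power_trace_mx Q).
    rewrite -[peval Q _]/(_ (\det _)) -(@det_map_mx _ _ (peval Q)).
    by rewrite map_power_trace_mx -/(poly_map _ _) poly_map_generic.
  split=> [[Qs Q0] p|h].
    rewrite inE => /orP[/eqP->|/mapP[[i j] _ ->]]; first by rewrite evdet.
    by rewrite peval_entry !poly_mapE Qs subrr mxE.
  split; last by rewrite -evdet h ?mem_head.
  apply/eqP; rewrite -subr_eq0; apply/eqP/matrixP=> i j.
  rewrite [RHS]mxE -(h ((Y^T - Y) i j)) ?peval_entry ?poly_mapE //.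
  by rewrite inE; apply/orP; right; apply/mapP; exists (i, j); rewrite ?mem_enum.
(* A symmetric matrix off the locus: diag(0, 1, ..., n - 1). *)
pose d : 'rV[F]_n := \row_i i%:R; exists (diag_mx d).
split; first exact: tr_diag_mx.
case=> _ /eqP; apply/negP; apply/(det_power_trace_neq0 (mul1mx 1%:M)).
  by rewrite mul1mx mulmx1.
by move=> i j; rewrite !mxE => /eqP; rewrite eqr_nat => /eqP/val_inj.
Qed.

Lemma orthonormal_eigenbasis_diag (F : fieldType) n (A U : 'M[F]_n) :
  orthonormal_eigenbasis A U ->
  exists d : 'rV[F]_n, A *m U = U *m diag_mx d.
Proof.
case=> _ /fin_all_exists[l hl]; exists (\row_i l i).
apply/matrixP=> a i; rewrite mul_mx_diag !mxE mulrC.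
by have /matrixP/(_ a 0) := hl i; rewrite !mxE => <-; apply: eq_bigr => j _; rewrite !mxE.
Qed.

(** Both a and b are the factor by which A scales u *m v^T, according to whether
    A acts on u or, by symmetry, on v. *)
Lemma eigenrows_orthogonal (F : fieldType) n (A : 'M[F]_n) (u v : 'rV[F]_n) a b :
  A^T = A -> a != b -> u *m A = a *: u -> v *m A = b *: v -> u *m v^T = 0.
Proof.
move=> sA; rewrite -subr_eq0 => /scalerI ab uA vA; apply: ab.
rewrite scaler0 scalerBl !scalemxAl -uA.
rewrite -scalemxAl scalemxAr -linearZ -vA /= trmx_mul sA mulmxA.
by rewrite subrr.
Qed.

(** The complex spectral theorem makes A unitarily diagonalisable with real
    eigenvalues, which are pairwise distinct as the discriminant is not 0.  A
    real eigenvalue of a real matrix has a real eigenvector, and eigenvectors for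
    distinct eigenvalues of a symmetric matrix are orthogonal, so it remains
    only to normalise them. *)
Lemma exists_orthonormal_eigenbasis (R : realType) n (A : 'M[R]_n) :
  A^T = A -> \det (power_trace_mx A) != 0 ->
  exists U : 'M[R]_n, orthonormal_eigenbasis A U.
Proof.
move=> sA detA; pose AC := map_mx (real_complex R) A.
have AC_real : AC \is a realmx.
  by apply/mxOverP => i j; rewrite mxE complex_real.
have AC_sym : AC \is symmetricmx.
  apply/is_hermitianmxP; rewrite expr0 scale1r map_mx_id //.
  by apply/matrixP=> i j; rewrite !mxE -[in LHS]sA mxE.
have /orthomx_spectralP := symmetric_normalmx AC_sym AC_real.
set P := spectralmx AC; set d := spectral_diag AC => AC_eq.
have Pu : P \in unitmx by apply: spectral_unit.
have d_real : d \is a realmx.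
  by apply: hermitian_spectral_diag_real; apply: realsym_hermsym.
have d_inj : injective (d 0).
  apply/(det_power_trace_neq0 (A := AC) (mulVmx Pu)).
    by rewrite {1}AC_eq mulmxK.
  by rewrite -map_power_trace_mx det_map_mx fmorph_eq0.
have eigen i : exists lv : R * 'rV[R]_n,
    [/\ d 0 i = (real_complex R) lv.1, lv.2 != 0 & lv.2 *m A = lv.1 *: lv.2].
  have /complex_realP[l dl] := mxOverP d_real 0 i.
  suff /eigenvalueP[v vA v0] : eigenvalue A l by exists (l, v).
  rewrite eigenvalue_root_char -(fmorph_root (real_complex R)) map_char_poly.
  rewrite -eigenvalue_root_char /= -dl; apply/eigenvalueP; exists (row i P).
    by rewrite -row_mul -/AC {1}AC_eq !mulmxA mulmxV // mul1mx row_mul row_diag_mx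
      -scalemxAl -rowE.
  apply/eqP=> /(congr1 (mulmxr (invmx P))) /=.
  rewrite -row_mul mulmxV // mul0mx => /rowP/(_ i)/eqP.
  by rewrite !mxE eqxx oner_eq0.
have {eigen}[lv /all_and3[dE v0 vA]] := fin_all_exists eigen.
have l_neq i j : i != j -> (lv i).1 != (lv j).1.
  by apply: contra_neq => lij; apply: d_inj; rewrite !dE lij.
pose N i := ((lv i).2 *m (lv i).2^T) 0 0.
have N_gt0 i : 0 < N i.
  have NE : N i = \sum_a (lv i).2 0 a ^+ 2.
    by rewrite /N mxE; apply: eq_bigr => a _; rewrite mxE.
  rewrite lt_def NE sumr_ge0 ?andbT => [|a _]; last exact: sqr_ge0.
  apply: contraNneq (v0 i) => /psumr_eq0P v2; apply/eqP/rowP=> a.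
  by apply/eqP; rewrite [X in _ == X]mxE -sqrf_eq0 v2 // => b _; apply: sqr_ge0.
pose w i := (Num.sqrt (N i))^-1 *: (lv i).2.
pose U : 'M[R]_n := \matrix_(a, i) w i 0 a.
have colU i : col i U = (w i)^T by apply/colP=> a; rewrite !mxE.
exists U; split=> [|i].
  apply/matrixP=> i j.
  have -> : (U^T *m U) i j = (w i *m (w j)^T) 0 0.
    by rewrite !mxE; apply: eq_bigr => a _; rewrite !mxE.
  have [<-|ij] := eqVneq i j; last first.
    rewrite [(w j)^T]linearZ -scalemxAl -scalemxAr.
    rewrite (eigenrows_orthogonal sA (l_neq _ _ ij)) // !scaler0 !mxE.
    by rewrite (negPf ij).
  have -> : (w i *m (w i)^T) 0 0 = (Num.sqrt (N i))^-1 ^+ 2 * N i.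
    by rewrite [(w i)^T]linearZ -scalemxAl -scalemxAr scalerA [LHS]mxE -expr2.
  by rewrite exprVn sqr_sqrtr ?ltW // mulVf ?gt_eqF // mxE eqxx.
exists (lv i).1; rewrite colU -[in LHS]sA -trmx_mul.
by rewrite -scalemxAl vA scalerA mulrC -scalerA linearZ.
Qed.

(** * The Young subgroup *)

Section ColourPreservingPermutations.

Variables (T I : finType) (f : T -> I).

(** Restricting to the fibres of f identifies such a permutation with a family
    of permutations, one supported in each fibre; the proof counts these families
    and glues them back. *)
Lemma card_colour_preserving :
  #|[set s : {perm T} | [forall x, f (s x) == f x]]| =
  (\prod_(a : I) #|[set x | f x == a]|`!)%N.
Proof.
pose fibre a := [set x | f x == a].
pose Fam := family (fun a : I => perm_on (fibre a) : pred {perm T}).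
have glueP (g : {ffun I -> {perm T}}) : g \in Fam ->
    forall x, f (g (f x) x) = f x.
  move=> /familyP gF x; have := perm_closed x (gF (f x)).
  by rewrite !inE eqxx => /eqP.
have glue_inj (g : {ffun I -> {perm T}}) : g \in Fam ->
    injective (fun x => g (f x) x).
  move=> gF x y gxy; have fxy : f x = f y by rewrite -(glueP g gF x) gxy glueP.
  by move: gxy; rewrite /= fxy => /perm_inj.
pose glue (g : {ffun I -> {perm T}}) : {perm T} :=
  if injectiveP (fun x => g (f x) x) is ReflectT inj then perm inj else 1%g.
have glueE g : g \in Fam -> glue g =1 (fun x => g (f x) x).
  move=> /glue_inj gF x; rewrite /glue.
  by case: injectiveP => [inj|/(_ gF)//]; rewrite permE.
transitivity #|Fam|; last first.
  rewrite card_family foldrE big_map big_enum; apply: eq_bigr => a _.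
  by rewrite card_perm.
rewrite -(card_in_imset (f := glue) (D := mem Fam)) => [|g h gF hF gh]; last first.
  apply/ffunP=> a; apply/permP=> x.
  have /familyP/(_ a) ga := gF; have /familyP/(_ a) ha := hF.
  have [fx|fx] := eqVneq (f x) a; last first.
    by rewrite (out_perm ga) ?(out_perm ha) // inE.
  by rewrite -fx -(glueE g gF) gh glueE.
apply: eq_card => s; rewrite inE; apply/forallP/imsetP => [sf|[g gF ->] x]; last first.
  by rewrite glueE // glueP.
have part_inj a : injective (fun x => if f x == a then s x else x).
  move=> x y; have [fx|fx] := eqVneq (f x) a; have [fy|fy] := eqVneq (f y) a => //.
  - exact: perm_inj.
  - by move=> sxy; rewrite -sxy (eqP (sf x)) fx eqxx in fy.
  - by move=> sxy; rewrite sxy (eqP (sf y)) fy eqxx in fx.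
exists [ffun a => perm (part_inj a)] => [|].
  apply/familyP=> a; rewrite ffunE; apply/subsetP=> x.
  by rewrite !inE permE; case: ifP => //; rewrite eqxx.
apply/permP=> x; rewrite glueE.
  by rewrite ffunE permE eqxx.
apply/familyP=> a; rewrite ffunE; apply/subsetP=> y.
by rewrite !inE permE; case: ifP => //; rewrite eqxx.
Qed.

End ColourPreservingPermutations.

Section Blocks.

Variables (n r : nat) (k : nat -> nat).
Hypotheses (hk0 : k 0%N = 0%N) (hk : forall j, (j < r)%N -> (k j < k j.+1)%N).
Hypotheses (hkr : (k r <= n)%N) (hkn : k r.+1 = n).

Lemma block_bounds_leq i j : (i <= j <= r.+1)%N -> (k i <= k j)%N.
Proof.
case/andP; elim: j => [|j IHj]; first by rewrite leqn0 => /eqP->.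
rewrite leq_eqVlt => /orP[/eqP->//|ij] jr; apply: leq_trans (IHj ij (ltnW jr)) _.
by move: jr; rewrite ltnS leq_eqVlt => /orP[/eqP->|/hk/ltnW//]; rewrite hkn.
Qed.

(** The blocks partition the indices, so that they are the fibres of a colouring;
    this turns all block conditions into equalities of colours. *)
Lemma exists_block_index :
  exists f : 'I_n -> 'I_r.+1, forall (j : 'I_r.+1) i, in_block k j i = (f i == j).
Proof.
have block (i : 'I_n) : exists j : 'I_r.+1, in_block k j i.
  have ex : exists j, (i < k j.+1)%N by exists r; rewrite hkn ltn_ord.
  have [j ij jmin] := ex_minnP ex.
  have jr : (j < r.+1)%N by rewrite ltnS jmin ?hkn ?ltn_ord.
  exists (Ordinal jr); rewrite /in_block /= ij andbT.
  case: j jmin {ij jr} => [|j] jmin; first by rewrite hk0.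
  by rewrite leqNgt; apply/negP => /jmin; rewrite ltnn.
have [f fP] := fin_all_exists block; exists f => j i.
apply/idP/eqP => [|<- //] /andP[kji ikj]; have /andP[kfi ikf] := fP i.
have no_lt (a b : 'I_r.+1) : (a < b)%N -> (i < k a.+1)%N -> (k b <= i)%N -> False.
  move=> ab ia ib; have : (k a.+1 <= k b)%N.
    by apply: block_bounds_leq; rewrite ab ltnW.
  by move/leq_trans/(_ ib)/(leq_trans ia); rewrite ltnn.
apply/val_inj; case: (ltngtP (f i) j) => // lt_fj; exfalso.
  exact: no_lt lt_fj ikf kji.
exact: no_lt lt_fj ikj kfi.
Qed.

(** Empty blocks are included: the last one is empty when k r = n. *)
Lemma card_block (j : 'I_r.+1) :
  #|[set i : 'I_n | in_block k j i]| = (k j.+1 - k j)%N.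
Proof.
rewrite -[RHS]card_ord.
have kj : (k j.+1 <= n)%N by rewrite -hkn block_bounds_leq // ltn_ord leqnn.
have lt (a : 'I_(k j.+1 - k j)) : (k j + a < n)%N.
  by apply: leq_trans kj; rewrite -ltn_subRL.
rewrite -(card_imset _ (f := fun a => Ordinal (lt a))) => [|a b [] /addnI/val_inj //].
apply: eq_card => i; rewrite inE /in_block; apply/idP/imsetP => [/andP[h1 h2]|[a _ ->]] /=.
  have ha : (i - k j < k j.+1 - k j)%N by rewrite ltn_sub2r // (leq_ltn_trans h1).
  by exists (Ordinal ha) => //; apply/val_inj; rewrite /= subnKC.
by rewrite leq_addr -ltn_subRL /=.
Qed.

Section Young.

Variable f : 'I_n -> 'I_r.+1.
Hypothesis fP : forall (j : 'I_r.+1) i, in_block k j i = (f i == j).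

Lemma same_blockE i i' : same_block r k i i' = (f i == f i').
Proof.
apply/existsP/idP => [[j]|/eqP e]; first by rewrite !fP => /andP[/eqP-> /eqP->].
by exists (f i); rewrite !fP -e !eqxx.
Qed.

Lemma mem_young s : (s \in young n r k) = [forall i, f (s i) == f i].
Proof.
rewrite inE; apply/forallP/forallP => [h i|h j].
  by have /forallP/(_ i) := h (f i); rewrite !fP eqxx.
by apply/forallP=> i; rewrite !fP; apply/implyP => /eqP <-.
Qed.

Lemma card_young : #|young n r k| = (\prod_(j < r.+1) (k j.+1 - k j)`!)%N.
Proof.
transitivity #|[set s : 'S_n | [forall i, f (s i) == f i]]|.
  by apply: eq_card => s; rewrite mem_young inE.
rewrite card_colour_preserving; apply: eq_bigr => j _; rewrite -card_block.
by congr (_`!); apply: eq_card => i; rewrite !inE fP.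
Qed.

End Young.

Lemma card_young_cosets :
  #|lcosets (young n r k) [set: 'S_n]| =
  (n`! %/ \prod_(j < r.+1) (k j.+1 - k j)`!)%N.
Proof.
have [f fP] := exists_block_index.
rewrite card_lcosets -divgS ?subsetT // -(card_young fP).
by congr (_ %/ _)%N; rewrite cardsT card_Sn.
Qed.

End Blocks.

(** * Rigidity and the coset varieties *)

Section ConjugatesOfDiagonal.

Variables (F : fieldType) (n : nat).
Implicit Types (A U W Q R : 'M[F]_n) (c d : 'rV[F]_n).

(** W^T D W commutes with X iff D commutes with W X W^T, which is then diagonal
    because D has no repeated entry; so W maps each eigenspace of X onto a span
    of standard basis vectors, and s records which ones. *)
Lemma commute_conj_diagP d c W : injective (d 0) -> W^T *m W = 1%:M ->
  W^T *m diag_mx d *m W *m diag_mx c = diag_mx c *m (W^T *m diag_mx d *m W) <->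
  exists s : 'S_n, forall i j, W i j != 0 -> c 0 j = c 0 (s i).
Proof.
move=> d_inj WtW; have WWt := mulmx1C WtW; split=> [comm|[s sP]].
  pose Y := W *m diag_mx c *m W^T.
  have dY : diag_mx d *m Y = Y *m diag_mx d.
    have : W *m (W^T *m diag_mx d *m W *m diag_mx c) *m W^T =
           W *m (diag_mx c *m (W^T *m diag_mx d *m W)) *m W^T by rewrite comm.
    by rewrite /Y !mulmxA WWt mul1mx -!mulmxA WWt mulmx1.
  have Y_diag i j : i != j -> Y i j = 0.
    apply: contraNeq => Yij; apply/eqP/d_inj/(mulfI Yij).
    by have /matrixP/(_ i j) := dY; rewrite mul_diag_mx mul_mx_diag !mxE mulrC.
  have YW i j : W i j != 0 -> c 0 j = Y i i.
    move=> Wij; apply: (mulfI Wij).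
    have /matrixP/(_ i j) : W *m diag_mx c = Y *m W.
      by rewrite /Y -!mulmxA WtW mulmx1.
    rewrite mul_mx_diag mxE => ->; rewrite [LHS]mxE (bigD1 i) //= big1 ?addr0.
      by rewrite mulrC.
    by move=> l li; rewrite Y_diag ?mul0r // eq_sym.
  have [s sP] : exists s : 'S_n, forall i, W i (s i) != 0.
    (* Otherwise every term of the Leibniz expansion of det W vanishes. *)
    suff /existsP[s /forallP sP] : [exists s : 'S_n, [forall i, W i (s i) != 0]].
      by exists s.
    have : \det W != 0 by rewrite -unitfE -unitmxE; case: (mulmx1_unit WtW).
    apply: contraR => /existsPn no_s; rewrite /determinant big1 // => s _.
    have [ i ] := forallPn (no_s s).
    by rewrite negbK => /eqP Wis; rewrite (bigD1 i) //= Wis mul0r mulr0.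
  by exists s => i j /YW ->; rewrite (YW i (s i)).
(* Conversely W X = X' W, where X' lists the entries of X permuted by s. *)
pose c' := \row_i c 0 (s i).
have Wc : W *m diag_mx c = diag_mx c' *m W.
  apply/matrixP=> i j; rewrite mul_mx_diag mul_diag_mx !mxE mulrC.
  by have [->|/sP->//] := eqVneq (W i j) 0; rewrite !mulr0.
have cWt : diag_mx c *m W^T = W^T *m diag_mx c'.
  by rewrite -[diag_mx c]tr_diag_mx -trmx_mul Wc trmx_mul tr_diag_mx.
by rewrite -[LHS]mulmxA Wc mulmxA -(mulmxA W^T) diag_mxC !mulmxA -cWt.
Qed.

End ConjugatesOfDiagonal.

Section CosetVarieties.

Variables (F : fieldType) (n r : nat) (k : nat -> nat).
Variable f : 'I_n -> 'I_r.+1.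
Hypothesis fP : forall (j : 'I_r.+1) i, in_block k j i = (f i == j).
Implicit Types (A U W Q R : 'M[F]_n) (c d : 'rV[F]_n) (S : {set 'S_n}).

(** Describes the piece of s by conditions on the coordinates of Q in the
    eigenbasis U, without the existential over block orthogonal matrices. *)
Lemma coset_variety_coord U s Q : U^T *m U = 1%:M ->
  coset_variety r k U (s *: young n r k)%g Q <->
  block_orthogonal r k (row_perm s^-1 (U^T *m Q)).
Proof.
move=> UtU; rewrite coset_varietyE; split=> [[R hR ->]|hR].
  by rewrite mulmxA UtU mul1mx -row_permM mulVg row_perm1.
exists (row_perm s^-1 (U^T *m Q)) => //.
by rewrite -row_permM mulgV row_perm1 mulmxA (mulmx1C UtU) mul1mx.
Qed.

Lemma orthogonal_row_perm s W :
  (row_perm s W)^T *m row_perm s W = 1%:M <-> W^T *m W = 1%:M.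
Proof.
rewrite row_permE trmx_mul mulmxA -(mulmxA W^T) tr_perm_mx -perm_mxM mulVg.
by rewrite perm_mx1 mulmx1.
Qed.

Lemma block_orthogonal_row_perm s W :
  block_orthogonal r k (row_perm s^-1 W) <->
  W^T *m W = 1%:M /\ forall i j, W i j != 0 -> f j = f (s i).
Proof.
rewrite /block_orthogonal orthogonal_row_perm.
split=> -[WtW h]; split=> // i j.
  apply: contraNeq => fij; have := h (s i) j.
  by rewrite mxE permK => ->; rewrite ?(same_blockE fP) // eq_sym.
rewrite (same_blockE fP) mxE; apply: contraNeq => /h ->.
by rewrite permKV.
Qed.

Lemma critical_cosets A U c d Q : 2%:R != 0 :> F -> A^T = A ->
  (forall i j, (c 0 i == c 0 j) = (f i == f j)) ->
  U^T *m U = 1%:M -> A *m U = U *m diag_mx d -> injective (d 0) ->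
  critical_point A (diag_mx c) Q <->
  exists2 S, S \in lcosets (young n r k) [set: 'S_n] & coset_variety r k U S Q.
Proof.
move=> two_neq0 sA cf UtU AU d_inj; have UUt := mulmx1C UtU.
rewrite critical_pointE ?tr_diag_mx //.
pose W := U^T *m Q.
have QtQ : Q^T *m Q = W^T *m W.
  by rewrite trmx_mul trmxK mulmxA -(mulmxA Q^T) UUt mulmx1.
have QAQ : Q^T *m A *m Q = W^T *m diag_mx d *m W.
  rewrite trmx_mul trmxK -!mulmxA; congr (_ *m _).
  by rewrite !mulmxA -AU -(mulmxA A) UUt mulmx1.
rewrite QtQ QAQ; split=> [[WtW]|[S /lcosetsP[s _ ->]]].
  move/(commute_conj_diagP c d_inj WtW) => [s sP].
  exists (s *: young n r k)%g; first by apply/lcosetsP; exists s; rewrite ?inE.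
  apply/coset_variety_coord => //; apply/block_orthogonal_row_perm; split=> //.
  by move=> i j /sP/eqP; rewrite cf => /eqP.
move/(coset_variety_coord _ _ UtU)/block_orthogonal_row_perm => [WtW sP].
split=> //; apply/(commute_conj_diagP c d_inj WtW); exists s => i j /sP fij.
by apply/eqP; rewrite cf fij.
Qed.

(** A row of an orthogonal matrix has an entry other than 0, whose column reveals
    the block to which the row is sent: s and t send each row to the same block,
    so they differ by an element of the Young subgroup. *)
Lemma coset_varieties_disjoint U S S' Q : U^T *m U = 1%:M ->
  S \in lcosets (young n r k) [set: 'S_n] ->
  S' \in lcosets (young n r k) [set: 'S_n] ->
  coset_variety r k U S Q -> coset_variety r k U S' Q -> S = S'.
Proof.
move=> UtU /lcosetsP[s _ ->] /lcosetsP[t _ ->].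
move=> /(coset_variety_coord _ _ UtU)/block_orthogonal_row_perm[WtW sP].
move=> /(coset_variety_coord _ _ UtU)/block_orthogonal_row_perm[_ tP].
apply/lcoset_eqP; rewrite mem_lcoset (mem_young fP); apply/forallP=> i.
rewrite permM; set a := (t^-1)%g i.
have [j Waj] : exists j, (U^T *m Q) a j != 0.
  apply/existsP; apply: contraT => /existsPn W0.
  have /matrixP/(_ a a)/eqP := mulmx1C WtW; rewrite !mxE eqxx big1 ?[0 == _]eq_sym ?oner_eq0 //.
  by move=> j _; rewrite (eqP (negbNE (W0 j))) mul0r.
by rewrite -(sP _ _ Waj) (tP _ _ Waj) /a permKV.
Qed.

Lemma coset_variety_algebraic U s : U^T *m U = 1%:M ->
  algebraic_set (coset_variety r k U (s *: young n r k)%g).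
Proof.
move=> UtU; pose P := const_poly_mx (perm_mx s^-1 *m U^T) *m generic_mx F n.
pose offdiag : 'M[{mpoly F[n * n]}]_n :=
  \matrix_(i, j) if same_block r k i j then 0 else P i j.
have PE Q : poly_map P Q = row_perm s^-1 (U^T *m Q).
  by rewrite !poly_mapE row_permE mulmxA.
have offE Q : poly_map offdiag Q =
    \matrix_(i, j) if same_block r k i j then 0 else row_perm s^-1 (U^T *m Q) i j.
  apply/matrixP=> i j; rewrite -PE -peval_entry !mxE; case: ifP => _ //.
  by rewrite rmorph0.
apply: (@algebraic_set_entries _ _ [:: P^T *m P - 1%:M; offdiag]) => Q.
rewrite coset_variety_coord // /block_orthogonal -PE.
split=> [[h1 h2] M|h].
  rewrite !inE => /orP[]/eqP->; first by rewrite !(poly_mapE, h1) subrr.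
  by rewrite offE -PE; apply/matrixP=> i j; rewrite [LHS]mxE [RHS]mxE; case: ifPn => // /h2.
split=> [|i j ij].
  apply/eqP; rewrite -subr_eq0; apply/eqP.
  by rewrite -(h (P^T *m P - 1%:M)) ?inE ?eqxx // !poly_mapE.
have /matrixP/(_ i j) : poly_map offdiag Q = 0 by apply: h; rewrite !inE eqxx orbT.
by rewrite offE mxE (negPf ij) -PE [in RHS]mxE.
Qed.

Lemma coset_variety_isomorphic U s : U^T *m U = 1%:M ->
  isomorphic_varieties (coset_variety r k U (s *: young n r k)%g)
    (block_orthogonal r k).
Proof.
move=> UtU.
exists (const_poly_mx (perm_mx s^-1 *m U^T) *m generic_mx F n).
exists (const_poly_mx (U *m perm_mx s) *m generic_mx F n).
have LE Q : perm_mx s^-1 *m U^T *m Q = row_perm s^-1 (U^T *m Q).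
  by rewrite row_permE mulmxA.
have LM : perm_mx s^-1 *m U^T *m (U *m perm_mx s) = 1%:M.
  by rewrite mulmxA -(mulmxA _ U^T) UtU mulmx1 -perm_mxM mulVg perm_mx1.
split=> Q; rewrite !poly_mapE => hQ; split.
- by rewrite LE; apply/coset_variety_coord.
- by rewrite mulmxA (mulmx1C LM) mul1mx.
- by apply/coset_variety_coord; rewrite // -LE mulmxA LM mul1mx.
- by rewrite mulmxA LM mul1mx.
Qed.

End CosetVarieties.

(** * The critical locus *)

Theorem theorem3p6 (R : realType) (n r : nat) (k : nat -> nat)
    (hr : (0 < r)%N) (hk0 : k 0%N = 0%N)
    (hk : forall j, (j < r)%N -> (k j < k j.+1)%N)
    (hkr : (k r <= n)%N) (hkn : k r.+1 = n) :
  exists Z : 'M[R]_n -> Prop, proper_closed_sym Z /\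
  forall A : 'M[R]_n, A^T = A -> ~ Z A ->
  forall c : 'rV[R[i]]_n,
    (forall (j : 'I_r.+1) (i i' : 'I_n),
        in_block k j i -> in_block k j i' -> c 0 i = c 0 i') ->
    (forall (j j' : 'I_r.+1) (i i' : 'I_n), j != j' ->
        in_block k j i -> in_block k j' i' -> c 0 i <> c 0 i') ->
    let AC : 'M[R[i]]_n := map_mx (real_complex R) A in
    let crit := critical_point AC (diag_mx c) in
    let cosets := lcosets (young n r k) [set: 'S_n] in
    [/\ algebraic_set crit,
        exists U : 'M[R]_n, orthonormal_eigenbasis A U
      & forall U : 'M[R]_n, orthonormal_eigenbasis A U ->
        let V := coset_variety r k (map_mx (real_complex R) U) in
        [/\ forall Q, crit Q <-> (exists2 S, S \in cosets & V S Q),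
            forall S S', S \in cosets -> S' \in cosets -> S != S' ->
              forall Q, ~ (V S Q /\ V S' Q),
            #|cosets| = (n`! %/ \prod_(j < r.+1) (k j.+1 - k j)`!)%N
          & forall S, S \in cosets ->
              algebraic_set (V S) /\
              isomorphic_varieties (V S) (block_orthogonal r k)]].
Proof.
have [f fP] := exists_block_index hk0 hk hkr hkn.
exists (@repeated_eigenvalue_locus R n).
split; first exact: repeated_eigenvalue_locus_proper.
move=> A sA A_generic c c_eq c_neq AC crit cosets.
have detA : \det (power_trace_mx A) != 0.
  by apply/eqP=> detA; apply: A_generic.
have cf i j : (c 0 i == c 0 j) = (f i == f j).
  have [fij|fij] := eqVneq (f i) (f j).
    by apply/eqP/(c_eq (f i)); rewrite fP ?fij.
  by apply/eqP/(c_neq _ _ _ _ fij); rewrite fP.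
have two_neq0 : 2%:R != 0 :> R[i] by rewrite pnatr_eq0.
have sAC : AC^T = AC by apply/matrixP=> i j; rewrite !mxE -[in RHS]sA mxE.
split.
- by apply: critical_set_algebraic; rewrite ?tr_diag_mx.
- exact: exists_orthonormal_eigenbasis.
move=> U eigU V; have [UtU _] := eigU.
have [d AU] := orthonormal_eigenbasis_diag eigU.
have d_inj : injective (d 0).
  exact/(det_power_trace_neq0 (mulmx1C UtU) AU).
pose UC := map_mx (real_complex R) U.
have UCtUC : UC^T *m UC = 1%:M.
  rewrite -[1%:M](map_mx1 (real_complex R)) -UtU map_mxM; congr (_ *m _).
  by apply/matrixP=> i j; rewrite !mxE.
have AUC : AC *m UC = UC *m diag_mx (map_mx (real_complex R) d).
  by rewrite -map_diag_mx -!map_mxM AU.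
have dC_inj : injective (map_mx (real_complex R) d 0).
  by move=> i j; rewrite !mxE => /complexI/d_inj.
split.
- by move=> Q; apply: critical_cosets UCtUC AUC dC_inj.
- move=> S S' hS hS' SS' Q [SQ S'Q]; move/eqP: SS'; apply.
  exact: coset_varieties_disjoint SQ S'Q.
- exact: card_young_cosets.
move=> S /lcosetsP[s _ ->]; split; first exact: coset_variety_algebraic.
exact: coset_variety_isomorphic.
Qed.
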